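(* There are $\mathrm{FO}^2(V_{\textit{ancOf}})$ sentences $\varphi_n$ of size $O(n)$ that are satisfiable over binary trees satisfying the unary alphabet restriction, such that the minimum depth of a binary tree satisfying the unary alphabet restriction and $\varphi_n$ grows as $2^n$.
   Context: Trees are finite ordered labelled trees; binary trees are trees in which each node has at most two children. A tree satisfies the unary alphabet restriction (UAR) if exactly one unary predicate holds at each node. $V_{\textit{ancOf}}$ consists of the unary predicates, equality, and the ancestor relation $\mathrm{AncOf}$. $\mathrm{FO}^2(V)$ is first-order logic over $V$ with at most two variables in every subformula. *)

(* Defs.v *)
From mathcomp Require Import all_boot.

Set Implicit Arguments.
Unset Strict Implicit.
Unset Printing Implicit Defensive.

(* Nonempty finite ordered trees; a node carries the set of unary predicates
   (from the alphabet Sigma) that hold at it. *)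
Inductive tree (Sigma : finType) : Type := Node of {set Sigma} & seq (tree Sigma).

Definition root_label (Sigma : finType) (t : tree Sigma) : {set Sigma} :=
  let: Node a _ := t in a.

Definition children (Sigma : finType) (t : tree Sigma) : seq (tree Sigma) :=
  let: Node _ ts := t in ts.

(* Nodes are addressed by the sequence of child indices leading to them from
   the root [::]; the result is None when there is no node at address p. *)
Fixpoint subtree (Sigma : finType) (t : tree Sigma) (p : seq nat) : option (tree Sigma) :=
  if p is i :: q then obind (fun u => subtree u q) (onth (children t) i)
  else Some t.

Definition is_node (Sigma : finType) (t : tree Sigma) (p : seq nat) : bool :=
  isSome (subtree t p).

Definition holds (Sigma : finType) (t : tree Sigma) (a : Sigma) (p : seq nat) : bool :=
  if subtree t p is Some u then a \in root_label u else false.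

(* The ancestor relation is proper: no node is an ancestor of itself. *)
Definition ancestor (p q : seq nat) : bool := prefix p q && (p != q).

Definition binary (Sigma : finType) (t : tree Sigma) : Prop :=
  forall p u, subtree t p = Some u -> size (children u) <= 2.

Definition UAR (Sigma : finType) (t : tree Sigma) : Prop :=
  forall p, is_node t p -> exists! a : Sigma, holds t a p.

(* Number of edges on a longest path from the root to a leaf. *)
Fixpoint depth (Sigma : finType) (t : tree Sigma) : nat :=
  let: Node _ ts := t in foldr (fun u d => maxn (depth u).+1 d) 0 ts.

(* First-order logic over the unary predicates Sigma, equality and AncOf, with
   variables named by natural numbers. *)
Inductive formula (Sigma : finType) : Type :=
  | Pred of Sigma & nat
  | Eq of nat & nat
  | AncOf of nat & nat
  | Not of formula Sigma
  | And of formula Sigma & formula Sigma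
  | Or of formula Sigma & formula Sigma
  | Ex of nat & formula Sigma
  | All of nat & formula Sigma.

Arguments Eq {Sigma}.
Arguments AncOf {Sigma}.

(* Number of occurrences of symbols, parentheses excluded; a predicate or
   variable name counts as one symbol. *)
Fixpoint fsize (Sigma : finType) (f : formula Sigma) : nat :=
  match f with
  | Pred _ _ => 2
  | Eq _ _ | AncOf _ _ => 3
  | Not g => (fsize g).+1
  | And g h | Or g h => (fsize g + fsize h).+1
  | Ex _ g | All _ g => (fsize g).+2
  end.

(* All variables occurring in f, free, bound or merely quantified. *)
Fixpoint vars (Sigma : finType) (f : formula Sigma) : seq nat :=
  match f with
  | Pred _ x => [:: x]
  | Eq x y | AncOf x y => [:: x; y]
  | Not g => vars g
  | And g h | Or g h => vars g ++ vars h
  | Ex x g | All x g => x :: vars g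
  end.

Fixpoint free_vars (Sigma : finType) (f : formula Sigma) : seq nat :=
  match f with
  | Pred _ x => [:: x]
  | Eq x y | AncOf x y => [:: x; y]
  | Not g => free_vars g
  | And g h | Or g h => free_vars g ++ free_vars h
  | Ex x g | All x g => [seq y <- free_vars g | y != x]
  end.

Definition sentence (Sigma : finType) (f : formula Sigma) : bool :=
  nilp (free_vars f).

Fixpoint subformulas (Sigma : finType) (f : formula Sigma) : seq (formula Sigma) :=
  f :: match f with
       | Pred _ _ | Eq _ _ | AncOf _ _ => [::]
       | Not g | Ex _ g | All _ g => subformulas g
       | And g h | Or g h => subformulas g ++ subformulas h
       end.

Definition FO2 (Sigma : finType) (f : formula Sigma) : bool :=
  all (fun g => size (undup (vars g)) <= 2) (subformulas f).

Definition update (v : nat -> seq nat) (x : nat) (p : seq nat) :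
  nat -> seq nat := fun y => if y == x then p else v y.

Fixpoint sat (Sigma : finType) (t : tree Sigma) (v : nat -> seq nat) (f : formula Sigma) :
  Prop :=
  match f with
  | Pred a x => holds t a (v x)
  | Eq x y => v x = v y
  | AncOf x y => ancestor (v x) (v y)
  | Not g => ~ sat t v g
  | And g h => sat t v g /\ sat t v h
  | Or g h => sat t v g \/ sat t v h
  | Ex x g => exists p, is_node t p /\ sat t (update v x p) g
  | All x g => forall p, is_node t p -> sat t (update v x p) g
  end.

(* For sentences the valuation is irrelevant; the constant root valuation is
   used. *)
Definition satisfies (Sigma : finType) (t : tree Sigma) (f : formula Sigma) : Prop :=
  sat t (fun _ => [::]) f.

Definition binary_UAR_model (Sigma : finType) (f : formula Sigma) (t : tree Sigma) : Prop :=
  [/\ binary t, UAR t & satisfies t f].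

Definition min_depth (Sigma : finType) (f : formula Sigma) (d : nat) : Prop :=
  (exists2 t, binary_UAR_model f t & depth t = d) /\
  (forall t, binary_UAR_model f t -> d <= depth t).

Definition bigO (f g : nat -> nat) : Prop :=
  exists C N : nat, forall n, N <= n -> f n <= C * g n.

Definition bigTheta (f g : nat -> nat) : Prop := bigO f g /\ bigO g f.

(* Main.v *)
Require Import Defs.
From mathcomp Require Import all_boot zify.
From Stdlib Require Import ClassicalEpsilon.

Set Implicit Arguments.
Unset Strict Implicit.
Unset Printing Implicit Defensive.

(** A model consists of a chain of spine nodes from which legs hang off.  The root of
    a leg has only spine nodes as proper ancestors, so the tree being binary there are
    at most two such roots at each level.  A leg root carries an (n+1)-bit word: bit i
    is 1 when some descendant has the label [one i].  The sentence makes the words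
    closed under the de Bruijn shifts w |-> c :: w (dropping the last bit), which only
    takes O(n) symbols because it compares bit i+1 of one word with bit i of another;
    hence all 2^(n+1) words occur, and the depth is at least 2^n - 1.  Conversely, a
    caterpillar whose legs list all the words is a model of depth O(2^n). *)

(** * Addresses, ancestors and depth in a tree *)

Section Trees.
Variable Sigma : finType.
Implicit Types (t u : tree Sigma) (p q : seq nat) (a b : Sigma).

Lemma subtree_cat t p q :
  subtree t (p ++ q) = obind (fun u => subtree u q) (subtree t p).
Proof. by elim: p t => //= i p IHp t; case: onth => /=. Qed.

Lemma is_node_prefix t p q : is_node t (p ++ q) -> is_node t p.
Proof. by rewrite /is_node subtree_cat; case: subtree. Qed.

Lemma holds_node t a p : holds t a p -> is_node t p.
Proof. by rewrite /holds /is_node; case: subtree. Qed.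

Lemma onth_depth (A : {set Sigma}) ts i u :
  onth ts i = Some u -> depth u < depth (Node A ts).
Proof.
elim: ts i => [|t ts IHts] [|i] //=; first by case=> ->; rewrite leq_maxl.
by move/IHts => /= lt_u; rewrite leq_max lt_u orbT.
Qed.

Lemma is_node_depth t p : is_node t p -> size p <= depth t.
Proof.
elim: p t => [|i p IHp] [a ts] //; rewrite /is_node [subtree _ _]/=.
case ts_i: onth => [u|] //= /IHp le_p; exact: leq_ltn_trans le_p (onth_depth a ts_i).
Qed.

Lemma binary_last t p i : binary t -> is_node t (rcons p i) -> i < 2.
Proof.
move=> bin_t; rewrite /is_node -cats1 subtree_cat.
case t_p: subtree => [u|] //=; case u_i: onth => [w|] // _.
apply: leq_trans (bin_t _ _ t_p); rewrite ltnNge; apply/negP=> le_i.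
by move: u_i; rewrite onth_default.
Qed.

Lemma prefix_eq_size p q : prefix p q -> size p = size q -> p = q.
Proof. by rewrite prefixE => /eqP def_p eq_sz; rewrite -def_p eq_sz take_size. Qed.

Lemma ancestorP p q : reflect (exists2 r, r != [::] & q = p ++ r) (ancestor p q).
Proof.
apply: (iffP andP) => [[/prefixP[r ->] neq_p] | [r r_n0 ->]].
  by exists r => //; apply: contraNneq neq_p => ->; rewrite cats0.
split; first exact: prefix_prefix.
by apply: contraNneq r_n0 => /(congr1 (drop (size p))); rewrite drop_size drop_size_cat // => <-.
Qed.

End Trees.

Lemma or_not_imply (P Q : Prop) : ~ P \/ Q -> P -> Q.
Proof. by case. Qed.

(** * Derived connectives and a criterion for two variables *)

Section Formulas.
Variable Sigma : finType.
Implicit Types (t : tree Sigma) (f g : formula Sigma).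

Definition Imp f g := Or (Not f) g.

Definition Iff f g := Or (And f g) (And (Not f) (Not g)).

(** [Eq 0 0] plays the constant true. *)
Definition Conj (s : seq nat) (F : nat -> formula Sigma) :=
  foldr (fun i => And (F i)) (Eq 0 0) s.

Lemma sat_Iff t v f g : sat t v (Iff f g) -> (sat t v f <-> sat t v g).
Proof. by case=> -[]. Qed.

Lemma sat_Conj t v s F :
  sat t v (Conj s F) <-> forall i, i \in s -> sat t v (F i).
Proof.
elim: s => [|j s IHs] //=; split=> [[Fj /IHs Fs] i | Fs].
  by rewrite inE => /predU1P[-> | /Fs].
split; first by apply: Fs; rewrite mem_head.
by apply/IHs=> i s_i; apply: Fs; rewrite inE s_i orbT.
Qed.

(** Subformulas only use variables of [f], so all of them draw on the two names 0 and 1. *)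
Lemma FO2_vars f : all (fun x => x < 2) (vars f) -> FO2 f.
Proof.
move=> f_lt2; have: all (fun g => all (fun x => x < 2) (vars g)) (subformulas f).
  elim: f f_lt2 => [a x|x y|x y|g IHg|g IHg h IHh|g IHg h IHh|x g IHg|x g IHg] /= f_lt2;
    rewrite f_lt2 //= ?all_cat.
  - exact: IHg.
  - by move: f_lt2; rewrite all_cat => /andP[/IHg-> /IHh->].
  - by move: f_lt2; rewrite all_cat => /andP[/IHg-> /IHh->].
  - by case/andP: f_lt2 => _ /IHg.
  - by case/andP: f_lt2 => _ /IHg.
apply: sub_all => g /allP g_lt2.
apply: (@uniq_leq_size _ _ (iota 0 2)) (undup_uniq _) _ => x.
by rewrite mem_undup mem_iota => /g_lt2.
Qed.

End Formulas.

(** * The de Bruijn sentence, its variables and its size *)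

Definition label n : finType := option (option 'I_n.+1).

Definition spine {n} : label n := None.
Definition leg {n} : label n := Some None.
Definition one {n} (i : 'I_n.+1) : label n := Some (Some i).

Section Formula.
Variable n : nat.

(** For [x] equal to 0 or 1, [1 - x] is the other variable. Rebinding it keeps [x] as the only free
    variable, so bits of two nodes can be compared within two variables. *)
Definition bit (i x : nat) : formula (label n) :=
  Ex (1 - x) (And (AncOf x (1 - x)) (Pred (one (inord i)) (1 - x))).

Definition spine_chain : formula (label n) :=
  All 0 (All 1 (Imp (And (Pred spine 0) (Pred spine 1))
                    (Or (Eq 0 1) (Or (AncOf 0 1) (AncOf 1 0))))).

Definition legs_on_spine : formula (label n) :=
  All 0 (All 1 (Imp (And (Pred leg 1) (AncOf 0 1)) (Pred spine 0))).

Definition shift_closed (c : bool) : formula (label n) :=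
  All 0 (Imp (Pred leg 0)
    (Ex 1 (And (Pred leg 1)
      (And (if c then bit 0 1 else Not (bit 0 1))
           (Conj (iota 0 n) (fun i => Iff (bit i.+1 1) (bit i 0))))))).

Definition debruijn : formula (label n) :=
  And (And spine_chain legs_on_spine)
      (And (Ex 0 (Pred leg 0)) (And (shift_closed true) (shift_closed false))).

Lemma vars_Conj (P : pred nat) s (F : nat -> formula (label n)) :
  P 0 -> (forall i, all P (vars (F i))) -> all P (vars (Conj s F)).
Proof. by move=> P0 PF; elim: s => [|i s IHs] /=; rewrite ?P0 ?all_cat ?PF. Qed.

Lemma debruijn_FO2 : FO2 debruijn.
Proof. by apply: FO2_vars; rewrite /= !all_cat /= !vars_Conj. Qed.

Lemma debruijn_sentence : sentence debruijn.
Proof.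
have free_Conj s : [seq y <- [seq y <- free_vars
    (Conj s (fun i => Iff (bit i.+1 1) (bit i 0))) | y != 1] | y != 0] = [::].
  by elim: s => //= i s IHs; rewrite /= !filter_cat /= IHs.
by rewrite /sentence /= !free_Conj.
Qed.

Lemma fsize_debruijn : fsize debruijn <= 76 * n + 100.
Proof.
(* [bit] has 8 symbols and [Iff] copies both sides, giving 37, plus 1 for the conjunction. The two
   shift formulas together contribute 76 per bit. *)
have fsize_Conj s : fsize (Conj s (fun i => Iff (bit i.+1 1) (bit i 0))) = 38 * size s + 3.
  by elim: s => //= i s ->; lia.
by rewrite /= !fsize_Conj size_iota; lia.
Qed.

(** Shaped so that satisfaction of [bit i 0] and [bit i 1] unfolds to it by computation. *)
Definition has_bit (t : tree (label n)) (p : seq nat) (i : nat) : Prop :=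
  exists q, is_node t q /\ ancestor p q /\ holds t (one (inord i)) q.

(** * Lower bound: every binary model has exponential depth *)

Variable t : tree (label n).
Hypotheses (bin_t : binary t) (t_phi : satisfies t debruijn).

Lemma spine_comparable p q :
  holds t spine p -> holds t spine q -> prefix p q || prefix q p.
Proof.
move=> t_p t_q; have [[/(_ _ (holds_node t_p) _ (holds_node t_q))/or_not_imply chain _] _] := t_phi.
case: chain => //= [|[]]; rewrite /update /=.
- by move->; rewrite prefix_refl.
- by case/andP=> ->.
- by case/andP=> ->; rewrite orbT.
Qed.

Lemma leg_parent p i : holds t leg (rcons p i) -> holds t spine p.
Proof.
move=> t_pi; have := holds_node t_pi; rewrite -cats1 => /is_node_prefix t_p.
have [[_ /(_ _ t_p _ (holds_node t_pi))/or_not_imply on_spine] _] := t_phi.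
apply: on_spine; split=> //=; apply/ancestorP.
by exists [:: i]; rewrite // -cats1.
Qed.

Lemma leg_shift p (c : bool) : holds t leg p ->
  exists2 q, holds t leg q &
    (has_bit t q 0 <-> c) /\ (forall i, i < n -> has_bit t q i.+1 <-> has_bit t p i).
Proof.
move=> t_p; have: sat t (fun=> [::]) (shift_closed c).
  by case: t_phi => _ [_ []]; case: c.
move=> /(_ _ (holds_node t_p))/or_not_imply /(_ t_p)[q [t_q [q_leg [q0 /sat_Conj q_shift]]]].
exists q => //; split; first by case: (c) q0 => /= q0; split.
move=> i lt_i; have s_i : i \in iota 0 n by rewrite mem_iota.
exact: (sat_Iff (q_shift i s_i)).
Qed.

(** Start from any leg and shift in the bits of [w] from last to first. The starting leg has an
    unknown word, so only the first [size w] bits are controlled. *)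
Lemma leg_word (w : seq bool) :
  exists2 p, holds t leg p &
    forall i, i <= n -> i < size w -> has_bit t p i <-> nth false w i.
Proof.
elim: w => [|c w [p t_p p_w]].
  by have [_ [[p [_ t_p]] _]] := t_phi; exists p.
have [q t_q [q0 q_shift]] := leg_shift c t_p; exists q => // -[|i] //= lt_i lt_w.
by apply: iff_trans (q_shift i lt_i) (p_w i (ltnW lt_i) lt_w).
Qed.

(** The parents are comparable spine nodes at equal depth, hence equal, and the last index picks the
    child. *)
Lemma leg_inj p q : holds t leg p -> holds t leg q ->
  size p = size q -> last 0 p = last 0 q -> p = q.
Proof.
case: (lastP p) => [|p' i]; first by case: q.
case: (lastP q) => [|q' j]; first by rewrite size_rcons.
move=> /leg_parent t_p /leg_parent t_q; rewrite !size_rcons !last_rcons => -[eq_sz] ->.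
by case/orP: (spine_comparable t_p t_q) => /prefix_eq_size ->.
Qed.

Lemma debruijn_depth : 2 ^ n <= (depth t).+1.
Proof.
have /fin_all_exists[f /all_and2[f_leg f_word]] (w : n.+1.-tuple bool) : exists p,
    holds t leg p /\ forall i, i <= n -> has_bit t p i <-> nth false w i.
  have [p t_p p_w] := leg_word w; exists p; split=> // i le_i.
  by apply: p_w; rewrite ?size_tuple.
(* The default 0 covers a leg at the root, whose address is empty. *)
have last_lt2 w : last 0 (f w) < 2.
  have := holds_node (f_leg w); case: (lastP (f w)) => // p i.
  by rewrite last_rcons; apply: binary_last.
have size_lt w : size (f w) < (depth t).+1.
  by rewrite ltnS is_node_depth ?(holds_node (f_leg w)).
(* Distinct words have distinct legs, and level with last index determines a leg; counting gives
   2^(n+1) <= 2 * (depth t + 1). *)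
pose g w := (Ordinal (size_lt w), Ordinal (last_lt2 w)).
have g_inj : injective g.
  move=> w w' [eq_sz eq_last].
  have eq_f : f w = f w' by apply: leg_inj.
  apply/val_inj/(@eq_from_nth _ false); rewrite ?size_tuple // => i lt_i.
  have w_i := f_word w i lt_i; rewrite eq_f in w_i.
  by apply/idP/idP; [move/w_i/f_word | move/f_word/w_i]; apply.
have := leq_card g g_inj; rewrite card_tuple card_prod card_bool !card_ord expnS.
by rewrite mulnC leq_pmul2r.
Qed.

End Formula.

(** * Upper bound: a caterpillar model listing all words *)

Section Model.
Variable n : nat.
Implicit Types (p q r : seq nat) (a : label n) (l : seq (label n)) (ls : seq (seq (label n))).

(** A path, given as a list of at most one tree so that it can serve directly as the children of a
    node. *)
Definition chain l : seq (tree (label n)) :=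
  foldr (fun a ts => [:: Node [set a] ts]) [::] l.

Definition leg_tree l : tree (label n) := Node [set leg] (chain l).

(** Child 0 is a leg and child 1 continues the spine, so spine addresses are exactly the [nseq k 1]
    with [k <= size ls]. *)
Definition caterpillar ls : tree (label n) :=
  foldr (fun l t => Node [set spine] [:: leg_tree l; t]) (Node [set spine] [::]) ls.

Lemma forall_subtree (P : tree (label n) -> Prop) A ts :
  P (Node A ts) ->
  (forall i u, onth ts i = Some u -> forall p w, subtree u p = Some w -> P w) ->
  forall p w, subtree (Node A ts) p = Some w -> P w.
Proof.
move=> P_root P_ts [|i p] w /=; first by case=> <-.
by case ts_i: onth => [u|] //=; apply: P_ts ts_i _ _.
Qed.

Lemma caterpillar_shape ls p u : subtree (caterpillar ls) p = Some u ->
  size (children u) <= 2 /\ exists a, root_label u = [set a].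
Proof.
have chainP a l q w : subtree (Node [set a] (chain l)) q = Some w ->
    size (children w) <= 2 /\ exists b, root_label w = [set b].
  elim: l a q w => [|b l IHl] a; apply: forall_subtree => /=.
  - by split=> //; exists a.
  - by case.
  - by split=> //; exists a.
  - by case=> [|[]] //= _ [<-]; apply: IHl.
elim: ls p u => [|l ls IHls]; apply: forall_subtree => /=.
- by split=> //; exists spine.
- by case.
- by split=> //; exists spine.
- by case=> [|[|[]]] //= _ [<-]; [apply: chainP | apply: IHls].
Qed.

Lemma caterpillar_binary ls : binary (caterpillar ls).
Proof. by move=> p u /caterpillar_shape[]. Qed.

Lemma caterpillar_UAR ls : UAR (caterpillar ls).
Proof.
move=> p; rewrite /is_node /holds; case ls_p: subtree => [u|] // _.
have [_ [a ->]] := caterpillar_shape ls_p.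
by exists a; split=> [|b]; rewrite inE // => /eqP.
Qed.

Lemma holds_chain a l b p :
  holds (Node [set a] (chain l)) b p -> if p is [::] then b = a else b \in l.
Proof.
elim: l a p => [|c l IHl] a [|i p]; rewrite /holds /= ?inE.
- by move/eqP.
- by case: i.
- by move/eqP.
- case: i => [|[]] //= /IHl; case: p => [->|_ _ ->]; rewrite ?eqxx ?orbT //.
Qed.

Lemma holds_leg_tree l a :
  a \in l -> exists2 p, p != [::] & holds (leg_tree l) a p.
Proof.
rewrite /leg_tree; elim: l leg => [|c l IHl] b //; rewrite inE => /predU1P[-> | /(IHl c)[p _ l_p]].
  by exists [:: 0]; rewrite // /holds /= inE.
by exists (0 :: p).
Qed.

Lemma subtree_leg ls k p : k < size ls ->
  subtree (caterpillar ls) (nseq k 1 ++ 0 :: p) = subtree (leg_tree (nth [::] ls k)) p.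
Proof. by elim: ls k => // l ls IHls [|k] //= /IHls. Qed.

Lemma holds_spine ls k : k <= size ls -> holds (caterpillar ls) spine (nseq k 1).
Proof.
rewrite /holds; elim: ls k => [|l ls IHls] [|k] //=; rewrite ?inE //.
exact: IHls.
Qed.

Lemma caterpillar_node ls a p : holds (caterpillar ls) a p ->
  (exists2 k, k <= size ls & p = nseq k 1 /\ a = spine) \/
  exists2 k, k < size ls & exists2 q, p = nseq k 1 ++ 0 :: q &
    holds (leg_tree (nth [::] ls k)) a q.
Proof.
rewrite /holds; elim: ls p => [|l ls IHls] [|[|[|i]] p] //=; rewrite ?inE.
- by move/eqP; left; exists 0.
- by move/eqP; left; exists 0.
- by right; exists 0 => //; exists p.
- case/IHls=> [[k le_k [-> ->]] | [k lt_k [q -> l_q]]].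
    by left; exists k.+1.
  by right; exists k.+1 => //; exists q.
- by case: i.
Qed.

Lemma depth_caterpillar ls m :
  all (fun l => size l <= m) ls -> depth (caterpillar ls) <= size ls + m.+1.
Proof.
have depth_chain a l : depth (Node [set a] (chain l)) = size l.
  by elim: l a => //= b l IHl a; rewrite maxn0 (IHl b).
elim: ls => //= l ls IHls /andP[l_m /IHls ls_m].
rewrite maxn0 !geq_max addSn !ltnS ls_m andbT; have /= -> := depth_chain leg l.
by lia.
Qed.

(** A word is represented by the set [A] of positions of its 1 bits. *)
Definition leg_labels (A : {set 'I_n.+1}) : seq (label n) := [seq one i | i <- enum A].

Definition model : tree (label n) :=
  caterpillar [seq leg_labels A | A <- enum {set 'I_n.+1}].

Lemma model_spine p : holds model spine p -> exists k, p = nseq k 1.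
Proof.
case/caterpillar_node=> [[k _ [-> _]] | [k lt_k [q _ /holds_chain]]]; first by exists k.
rewrite size_map in lt_k.
by rewrite (nth_map set0) //; case: q => // i q /mapP[].
Qed.

Lemma model_leg p : holds model leg p -> exists A k,
  [/\ p = rcons (nseq k 1) 0, forall j, j <= k -> holds model spine (nseq j 1) &
      forall q, subtree model (p ++ q) = subtree (leg_tree (leg_labels A)) q].
Proof.
case/caterpillar_node=> [[k _ [_ //]] | [k lt_k [q -> /holds_chain]]].
have := lt_k; rewrite size_map => lt_k'; rewrite (nth_map set0) //.
case: q => [_|i q /mapP[] //].
exists (nth set0 (enum {set 'I_n.+1}) k), k; split=> [|j le_j|q]; first by rewrite -cats1.
  exact/holds_spine/(leq_trans le_j)/ltnW.
by rewrite -catA /= subtree_leg // (nth_map set0).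
Qed.

Lemma model_has_leg A : exists2 p, holds model leg p &
  forall q, subtree model (p ++ q) = subtree (leg_tree (leg_labels A)) q.
Proof.
pose k := index A (enum {set 'I_n.+1}).
have lt_k : k < size (enum {set 'I_n.+1}) by rewrite index_mem mem_enum.
have sub_leg q : subtree model ((nseq k 1 ++ [:: 0]) ++ q) = subtree (leg_tree (leg_labels A)) q.
  rewrite -catA subtree_leg ?(size_map (@leg_labels)) // (nth_map set0) // nth_index ?mem_enum //.
by exists (nseq k 1 ++ [:: 0]); rewrite // /holds -[_ ++ _]cats0 sub_leg /= inE.
Qed.

(** The proper descendants of [p] form a path labelled by the elements of [A]; a nonempty address
    below [p] avoids the leg root itself. *)
Lemma has_bit_leg t p A i :
  (forall q, subtree t (p ++ q) = subtree (leg_tree (leg_labels A)) q) ->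
  has_bit t p i <-> inord i \in A.
Proof.
move=> t_p; have mem_one j : (one j \in leg_labels A) = (j \in A).
  by rewrite mem_map ?mem_enum // => j1 j2 [].
have t_pE q a : holds t a (p ++ q) = holds (leg_tree (leg_labels A)) a q.
  by rewrite /holds t_p.
split=> [[_ [_ [/ancestorP[r r_n0 ->]]]] | A_i].
  by rewrite t_pE => /holds_chain; case: r r_n0 => // j r _; rewrite mem_one.
have [r r_n0 l_r] := @holds_leg_tree (leg_labels A) (one (inord i)) (etrans (mem_one _) A_i).
rewrite -t_pE in l_r; exists (p ++ r); split; first exact: holds_node l_r.
by split=> //; apply/ancestorP; exists r.
Qed.

Lemma model_spine_chain : satisfies model (spine_chain n).
Proof.
move=> p _ q _; case model_p: (holds model spine p); last by left; rewrite /= /update /= model_p => -[].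
case model_q: (holds model spine q); last by left; rewrite /= /update /= model_q => -[].
right; rewrite /= /update /=.
have [j ->] := model_spine model_p; have [k ->] := model_spine model_q.
have anc i m : i < m -> ancestor (nseq i 1) (nseq m 1).
  move=> lt_im; apply/ancestorP; exists (nseq (m - i) 1); last by rewrite -nseqD subnKC // ltnW.
  by rewrite -size_eq0 size_nseq subn_eq0 -ltnNge.
case: (ltngtP j k) => [/anc|/anc|->]; by [right; left | right; right | left].
Qed.

Lemma model_legs_on_spine : satisfies model (legs_on_spine n).
Proof.
move=> p p_model q _; case model_q: (holds model leg q); last by left; rewrite /= /update /= model_q => -[].
case anc_pq: (ancestor p q); last by left; rewrite /= /update /= anc_pq => -[].
right; rewrite /= /update /=.
have [_ [k [def_q model_k _]]] := model_leg model_q.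
have [r r_n0 q_pr] := ancestorP _ _ anc_pq.
(* The nonempty [r] contains the final 0 of the leg address, so [p] is a prefix of [nseq k 1], that
   is, a spine address. *)
case/lastP: r r_n0 q_pr => // r i _; rewrite def_q -rcons_cat => /rcons_inj[def_k _].
have le_k : size p <= k by rewrite -(size_nseq k 1) def_k size_cat leq_addr.
by have := model_k _ le_k; rewrite -(take_nseq 1 le_k) def_k take_size_cat.
Qed.

Lemma model_shift_closed c : satisfies model (shift_closed n c).
Proof.
move=> p _; case model_p: (holds model leg p); last by left; rewrite /= /update /= model_p.
right; have [A [k [_ _ sub_p]]] := model_leg model_p.
(* [B] is the word of [A] shifted by one with [c] put in front; position [n] of [A] is dropped. *)
pose B := [set j : 'I_n.+1 | if nat_of_ord j is i.+1 then inord i \in A else c].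
have [q model_q sub_q] := model_has_leg B.
exists q; split; first exact: holds_node model_q.
split=> //; split.
  have := has_bit_leg 0 sub_q; rewrite inE inordK //.
  by case: (c) => /= [] [q0 q1]; [exact: q1 | move/q0].
apply/sat_Conj=> i; rewrite mem_iota => /= lt_i.
have := has_bit_leg i.+1 sub_q; rewrite inE inordK //= => q_i.
have p_i := has_bit_leg i sub_p.
case: (inord i \in A) p_i q_i => p_i q_i; [left | right].
  by split; [apply/q_i | apply/p_i].
by split; [move/q_i | move/p_i].
Qed.

Lemma model_debruijn : satisfies model (debruijn n).
Proof.
split; first by split; [apply: model_spine_chain | apply: model_legs_on_spine].
split; last by split; [exact: (model_shift_closed true) | exact: (model_shift_closed false)].
by have [p model_p _] := model_has_leg set0; exists p; split; first exact: holds_node model_p.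
Qed.

Lemma depth_model : depth model <= 2 ^ n.+1 + n.+2.
Proof.
apply: leq_trans (depth_caterpillar (m := n.+1) _) _.
  apply/allP=> _ /mapP[A _ ->]; rewrite size_map -cardE.
  by have := max_card A; rewrite card_ord.
by rewrite (size_map (@leg_labels)) -cardT -cardsT -powersetT card_powerset cardsT card_ord.
Qed.

End Model.

(** * Existence and growth of the minimum depth *)

Lemma exists_min_depth (Sigma : finType) (f : formula Sigma) :
  (exists t, binary_UAR_model f t) -> exists d, min_depth f d.
Proof.
move=> [t f_t]; pose D d := exists2 t, binary_UAR_model f t & depth t = d.
(* Excluded middle turns [D] into a boolean predicate, to which least-number search applies. *)
pose decD d : bool := excluded_middle_informative (D d).
have decDP d : reflect (D d) (decD d) by apply: sumboolP.
have exD : exists d, decD d by exists (depth t); apply/decDP; exists t.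
case: (ex_minnP exD) => d /decDP D_d min_d; exists d; split=> // u f_u.
by apply: min_d; apply/decDP; exists u.
Qed.

Theorem mainTheorem8 :
  exists (Sigma : nat -> finType) (phi : forall n, formula (Sigma n)) (d : nat -> nat),
    [/\ forall n, FO2 (phi n) /\ sentence (phi n),
        bigO (fun n => fsize (phi n)) (fun n => n),
        forall n, exists t : tree (Sigma n), binary_UAR_model (phi n) t,
        forall n, min_depth (phi n) (d n)
      & bigTheta d (fun n => 2 ^ n)].
Proof.
have model_phi n : binary_UAR_model (debruijn n) (model n).
  split; [exact: caterpillar_binary | exact: caterpillar_UAR | exact: model_debruijn].
have ex_d n : exists d, min_depth (debruijn n) d.
  by apply: exists_min_depth; exists (model n).
pose d n := proj1_sig (constructive_indefinite_description _ (ex_d n)).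
have min_d n : min_depth (debruijn n) (d n) := proj2_sig (constructive_indefinite_description _ (ex_d n)).
exists label, debruijn, d; split=> //.
- by move=> n; split; [apply: debruijn_FO2 | apply: debruijn_sentence].
(* For n >= 1, 76 n + 100 <= 176 n. *)
- by exists 176, 1 => n n_gt0; have := fsize_debruijn n; lia.
- by move=> n; exists (model n).
split.
  (* Since n < 2^n, the term n + 2 is at most 2 * 2^n, adding to the 2^(n+1) from the spine. *)
  exists 4, 1 => n n_gt0; apply: leq_trans ((min_d n).2 _ (model_phi n)) _.
  apply: leq_trans (depth_model n) _; rewrite expnS.
  have := ltn_expl n (ltnSn 1); lia.
(* From 2 <= 2^n <= depth + 1 the depth is at least 1, so depth + 1 <= 2 * depth. *)
exists 2, 1 => n n_gt0; have [[t [bin_t _ t_phi] <-] _] := min_d n.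
have := debruijn_depth bin_t t_phi.
have : 2 ^ 1 <= 2 ^ n by rewrite leq_exp2l.
lia.
Qed.
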